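(* Let $(b,c)$ be a connected transient graph over $X$. Then the following assertions are equivalent. (i) Every bounded harmonic function is zero. (i.a) Every bounded superharmonic function is a potential. (i.b) Every bounded subharmonic function is negative (i.e., $\le0$). (i.c) Every bounded positive (i.e., $\ge0$) subharmonic function is zero. (ii.a) $Gc(x)=1$ for some (equivalently, all) $x\in X$, i.e., $1\in\mathcal{P}$.
   Context: Let $X$ be a countable set. A graph $(b,c)$ over $X$ consists of a symmetric function $b:X\times X\to[0,\infty)$ with $b(x,x)=0$ and $\sum_{y\in X}b(x,y)<\infty$ for all $x\in X$, and a function $c:X\to[0,\infty)$ (the killing term). The graph is connected if for all $x,y\in X$ there are $x=y_1,\dots,y_{n+1}=y$ with $b(y_i,y_{i+1})>0$ for $1\le i\le n$. Let $\mathcal{F}=\{f:X\to\mathbb{R}\mid \sum_y b(x,y)|f(y)|<\infty \text{ for all }x\}$ and, for $f\in\mathcal{F}$, $\mathcal{L}f(x)=\sum_y b(x,y)(f(x)-f(y))+c(x)f(x)$. A function $u\in\mathcal{F}$ is harmonic (superharmonic, subharmonic) if $\mathcal{L}u=0$ ($\ge0$, $\le0$) on $X$. Let $\mathcal{Q}(f)=\frac12\sum_{x,y}b(x,y)(f(x)-f(y))^2+\sum_x c(x)f(x)^2$, $\mathcal{D}=\{f:X\to\mathbb{R}\mid\mathcal{Q}(f)<\infty\}$, and let $\mathcal{D}_0$ be the closure of the finitely supported functions in $\mathcal{D}$ with respect to $\|f\|_o=\sqrt{\mathcal{Q}(f)+|f(o)|^2}$ for a fixed $o\in X$. The connected graph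 $(b,c)$ is transient if for every $y\in X$ there is a unique $G_y\in\mathcal{D}_0$ with $\mathcal{L}G_y=1_{\{y\}}$. The Green function is $G(x,y)=G_y(x)$, and $Gk(x)=\sum_yG(x,y)k(y)$ for $k\ge0$ (with values in $[0,\infty]$) or for $k\in\mathcal{G}=\{k:X\to\mathbb{R}\mid\sum_yG(x,y)|k(y)|<\infty\text{ for all }x\}$. The set of potentials is $\mathcal{P}=\{u\in\mathcal{F}\mid u=Gk\text{ for some }k\in\mathcal{G}\}$. *)

(* Defs.v *)
From HB Require Import structures.
From mathcomp Require Import all_boot all_order all_algebra.
From mathcomp Require Import all_classical all_reals all_analysis.

Set Implicit Arguments.
Unset Strict Implicit.
Unset Printing Implicit Defensive.

Import Order.TTheory GRing.Theory Num.Theory.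
Import numFieldNormedType.Exports.

Local Open Scope classical_set_scope.
Local Open Scope ring_scope.

(* [esum] is only meaningful for nonnegative terms, so a signed family is
   summed through its positive and negative parts: this is the usual sum when
   the family is nonnegative (possibly +oo) or absolutely summable. *)
Definition sgsum (R : realType) (X : countType) (f : X -> R) : \bar R :=
  (\esum_(x in [set: X]) (f^\+ x)%:E - \esum_(x in [set: X]) (f^\- x)%:E)%E.

Definition is_graph (R : realType) (X : countType)
    (b : X -> X -> R) (c : X -> R) : Prop :=
  [/\ forall x y, 0 <= b x y,
      forall x y, b x y = b y x,
      forall x, b x x = 0,
      forall x, (\esum_(y in [set: X]) (b x y)%:E < +oo)%E &
      forall x, 0 <= c x].

Definition connected_graph (R : realType) (X : countType)
    (b : X -> X -> R) : Prop :=
  forall x y, exists p : seq X, path (fun u v => 0 < b u v) x p /\ last x p = y.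

Definition calF (R : realType) (X : countType) (b : X -> X -> R) :
    set (X -> R) :=
  [set f | forall x, (\esum_(y in [set: X]) (b x y * `|f y|)%:E < +oo)%E].

(* [fine] loses nothing when [f] is in [calF b], which is required wherever
   [lapl] is used. *)
Definition lapl (R : realType) (X : countType) (b : X -> X -> R) (c : X -> R)
    (f : X -> R) (x : X) : R :=
  fine (sgsum (fun y => b x y * (f x - f y))) + c x * f x.

Definition is_harmonic (R : realType) (X : countType) (b : X -> X -> R)
    (c : X -> R) (u : X -> R) : Prop :=
  calF b u /\ forall x, lapl b c u x = 0.

Definition is_superharmonic (R : realType) (X : countType) (b : X -> X -> R)
    (c : X -> R) (u : X -> R) : Prop :=
  calF b u /\ forall x, 0 <= lapl b c u x.

Definition is_subharmonic (R : realType) (X : countType) (b : X -> X -> R)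
    (c : X -> R) (u : X -> R) : Prop :=
  calF b u /\ forall x, lapl b c u x <= 0.

Definition energy (R : realType) (X : countType) (b : X -> X -> R)
    (c : X -> R) (f : X -> R) : \bar R :=
  ((2^-1)%:E * \esum_(p in [set: X * X])
                  (b p.1 p.2 * (f p.1 - f p.2) ^+ 2)%:E
   + \esum_(x in [set: X]) (c x * f x ^+ 2)%:E)%E.

Definition calD (R : realType) (X : countType) (b : X -> X -> R)
    (c : X -> R) : set (X -> R) :=
  [set f | (energy b c f < +oo)%E].

(* A norm on [calD b c]; [fine] makes it meaningless outside. *)
Definition onorm (R : realType) (X : countType) (b : X -> X -> R)
    (c : X -> R) (o : X) (f : X -> R) : R :=
  Num.sqrt (fine (energy b c f) + `|f o| ^+ 2).

Definition calD0 (R : realType) (X : countType) (b : X -> X -> R)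
    (c : X -> R) (o : X) : set (X -> R) :=
  [set f | calD b c f /\
     forall e : R, 0 < e -> exists phi : X -> R,
       [/\ finite_set [set x | phi x != 0], calD b c phi
         & onorm b c o (f \- phi) < e]].

Definition is_green (R : realType) (X : countType) (b : X -> X -> R)
    (c : X -> R) (o y : X) (g : X -> R) : Prop :=
  [/\ calD0 b c o g, calF b g & forall x, lapl b c g x = \1_[set y] x].

Definition transient (R : realType) (X : countType) (b : X -> X -> R)
    (c : X -> R) (o : X) : Prop :=
  forall y, exists! g : X -> R, is_green b c o y g.

(* The default value 0 plays no role for a transient graph. *)
Definition green (R : realType) (X : countType) (b : X -> X -> R)
    (c : X -> R) (o x y : X) : R :=
  xget (fun=> 0) [set g : X -> R | is_green b c o y g] x.

Definition green_op (R : realType) (X : countType) (b : X -> X -> R)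
    (c : X -> R) (o : X) (k : X -> R) (x : X) : \bar R :=
  sgsum (fun y => green b c o x y * k y).

Definition calG (R : realType) (X : countType) (b : X -> X -> R)
    (c : X -> R) (o : X) : set (X -> R) :=
  [set k | forall x,
     (\esum_(y in [set: X]) (green b c o x y * `|k y|)%:E < +oo)%E].

Definition potential (R : realType) (X : countType) (b : X -> X -> R)
    (c : X -> R) (o : X) : set (X -> R) :=
  [set u | calF b u /\
     exists2 k, calG b c o k & forall x, (u x)%:E = green_op b c o k x].

(* Main.v *)
Require Import Defs.
From HB Require Import structures.
From mathcomp Require Import all_boot all_order all_algebra.
From mathcomp Require Import all_classical all_reals all_analysis.
From mathcomp Require Import ring lra.
Import Order.TTheory GRing.Theory Num.Theory.
Import numFieldNormedType.Exports.
Local Open Scope classical_set_scope.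
Local Open Scope ring_scope.

(* Comparison principle: if g is in D_0, s >= 0 and L g <= L s, then g <= s.
   Indeed, testing L (g - s) <= 0 against v = (phi - s)^+, where phi is finitely
   supported and close to g, bounds the energy of v by that of phi - g. Thus
   (g - s)^+ is a constant lying in D_0, and it vanishes since otherwise it could
   be added to a Green function. Consequently Gk <= s as soon as s >= 0 and
   0 <= k <= L s, while L (Gk) = k by Fubini. So 1 - Gc is a harmonic function
   with values in [0, 1], and s - G(L s) is harmonic between 0 and s for
   superharmonic s >= 0; apply this to s = M + u with |u| <= M. If Gc = 1 and u
   is harmonic, L (M + u) = M c gives M = G(M c) <= M + u, whence u >= 0. *)

(** * Unconditional sums of real families over a countable type *)

Section RealSums.
Context {R : realType}.

Definition absum {T : countType} (f : T -> R) : Prop :=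
  (\esum_(x in [set: T]) `|f x|%:E < +oo)%E.

(** Under [absum] both parts of [sgsum] are finite and [fine] returns the true sum; outside [absum]
    the value carries no meaning. *)
Definition rsum {T : countType} (f : T -> R) : R := fine (sgsum f).

Lemma absum_le {T : countType} (f g : T -> R) :
  (forall x, `|f x| <= g x) -> absum g -> absum f.
Proof.
move=> fg; apply: le_lt_trans; apply: le_esum => x _; rewrite lee_fin.
exact: le_trans (fg x) (ler_norm _).
Qed.

Lemma absumD {T : countType} (f g : T -> R) :
  absum f -> absum g -> absum (fun x => f x + g x).
Proof.
move=> sf sg; apply: le_lt_trans (lte_add_pinfty sf sg).
by rewrite -esumD//; apply: le_esum => x _; rewrite -EFinD lee_fin ler_normD.
Qed.

Lemma absumN {T : countType} (f : T -> R) :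
  absum f -> absum (fun x => - f x).
Proof.
by apply: le_lt_trans; apply: le_esum => x _; rewrite normrN.
Qed.

Lemma absumB {T : countType} (f g : T -> R) :
  absum f -> absum g -> absum (fun x => f x - g x).
Proof. by move=> sf sg; apply: absumD => //; exact: absumN. Qed.

Lemma esumZ {T : countType} (r : R) (f : T -> R) : 0 <= r ->
  (forall x, 0 <= f x) ->
  (\esum_(x in [set: T]) (r * f x)%:E =
   r%:E * \esum_(x in [set: T]) (f x)%:E)%E.
Proof.
move=> r0 f0; rewrite /esum -ereal_supZl//; last first.
  by apply/set0P; exists (\sum_(i \in set0) (f i)%:E)%E; exists set0.
congr ereal_sup; rewrite image_comp; apply: eq_imagel => A [finA _] /=.
by rewrite ge0_mule_fsumr// => i; rewrite lee_fin.
Qed.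

Lemma absumZ {T : countType} (r : R) (f : T -> R) :
  absum f -> absum (fun x => r * f x).
Proof.
rewrite /absum => sf.
under eq_esum do rewrite normrM.
by rewrite esumZ// lte_mul_pinfty// ?lee_fin.
Qed.

Lemma absum_fin {T : countType} (f : T -> R) :
  finite_set [set x | f x != 0] -> absum f.
Proof.
move=> finf; rewrite /absum.
rewrite (_ : esum _ _ = \esum_(x in [set x | f x != 0]) `|f x|%:E); last first.
  rewrite [RHS]esum_mkcond; apply: eq_esum => x _; case: ifPn => //.
  by rewrite notin_setE /= => /negP; rewrite negbK => /eqP ->; rewrite normr0.
by rewrite esum_fset// fsumEFin// ltry.
Qed.

Lemma ge0_absum {T : countType} (f : T -> R) : (forall x, 0 <= f x) ->
  absum f = (\esum_(x in [set: T]) (f x)%:E < +oo)%E.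
Proof. by move=> f0; rewrite /absum; under eq_esum do rewrite ger0_norm//. Qed.

Lemma ge0_sgsum {T : countType} (f : T -> R) : (forall x, 0 <= f x) ->
  sgsum f = (\esum_(x in [set: T]) (f x)%:E)%E.
Proof.
move=> f0; rewrite /sgsum [X in (_ - X)%E]esum1 ?sube0; last first.
  by move=> x _; rewrite (@ge0_funrnegE _ _ setT)// in_setT.
by apply: eq_esum => x _; rewrite (@ge0_funrposE _ _ setT)// in_setT.
Qed.

Lemma ge0_rsum {T : countType} (f : T -> R) : (forall x, 0 <= f x) ->
  absum f -> (rsum f)%:E = (\esum_(x in [set: T]) (f x)%:E)%E.
Proof.
move=> f0; rewrite ge0_absum// => sf; rewrite /rsum ge0_sgsum// fineK//.
by rewrite ge0_fin_numE// esum_ge0// => x _; rewrite lee_fin.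
Qed.

Lemma sgsum_rsum {T : countType} (f : T -> R) :
  absum f -> sgsum f = (rsum f)%:E.
Proof.
move=> sf; rewrite /rsum fineK// /sgsum.
have s g : (forall x, 0 <= g x) -> (forall x, g x <= `|f x|) ->
    (\esum_(x in [set: T]) (g x)%:E)%E \is a fin_num.
  move=> g0 gf; rewrite ge0_fin_numE; last first.
    by apply: esum_ge0 => x _; rewrite lee_fin.
  by apply: le_lt_trans sf; apply: le_esum => x _; rewrite lee_fin.
rewrite fin_numB !s// => x; rewrite ?funrpos_ge0 ?funrneg_ge0//.
  by rewrite /funrneg ge_max normr_ge0 -normrN ler_norm.
by rewrite /funrpos ge_max normr_ge0 ler_norm.
Qed.

Lemma eq_rsum {T : countType} (f g : T -> R) : f =1 g -> rsum f = rsum g.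
Proof. by move=> /funext ->. Qed.

Lemma ge0_rsumB {T : countType} (f g : T -> R) :
  (forall x, 0 <= f x) -> (forall x, 0 <= g x) -> absum f -> absum g ->
  rsum (fun x => f x - g x) = rsum f - rsum g.
Proof.
move=> f0 g0 sf sg; apply: EFin_inj.
rewrite -sgsum_rsum; last exact: absumB.
rewrite EFinB !ge0_rsum//.
rewrite -(@esumB _ _ setT (EFin \o f) (EFin \o g))//; last 2 first.
- by move=> x _; rewrite lee_fin.
- by move=> x _; rewrite lee_fin.
congr (_ - _)%E; apply: eq_esum => x _.
  by rewrite funeposE /funrpos EFin_max.
by rewrite funenegE /funrneg EFin_max EFinN.
Qed.

Lemma absum0 {T : countType} : absum (fun _ : T => 0).
Proof.
apply: absum_fin; rewrite (_ : mkset _ = set0)//.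
by apply/seteqP; split => x //=; rewrite eqxx.
Qed.

Lemma rsum0 {T : countType} : rsum (fun _ : T => 0) = 0.
Proof. by apply: EFin_inj; rewrite ge0_rsum ?esum1//; exact: absum0. Qed.

Lemma rsum_ge0 {T : countType} (f : T -> R) : (forall x, 0 <= f x) ->
  0 <= rsum f.
Proof.
by move=> f0; rewrite /rsum ge0_sgsum// fine_ge0// esum_ge0// => x _; rewrite lee_fin.
Qed.

Lemma absum_pos {T : countType} (f : T -> R) : absum f -> absum f^\+.
Proof.
apply: le_lt_trans; apply: le_esum => x _; rewrite lee_fin.
by rewrite ger0_norm ?funrpos_ge0// /funrpos ge_max normr_ge0 ler_norm.
Qed.

Lemma absum_neg {T : countType} (f : T -> R) : absum f -> absum f^\-.
Proof.
apply: le_lt_trans; apply: le_esum => x _; rewrite lee_fin.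
by rewrite ger0_norm ?funrneg_ge0// /funrneg ge_max normr_ge0 -normrN ler_norm.
Qed.

Lemma rsum_posneg {T : countType} (f : T -> R) :
  absum f -> rsum f = rsum f^\+ - rsum f^\-.
Proof.
move=> sf; rewrite -ge0_rsumB//; first last.
- exact: absum_neg.
- exact: absum_pos.
by apply: eq_rsum => x; rewrite -[in LHS](funrposBneg f).
Qed.

Lemma ge0_rsumD {T : countType} (f g : T -> R) :
  (forall x, 0 <= f x) -> (forall x, 0 <= g x) -> absum f -> absum g ->
  rsum (fun x => f x + g x) = rsum f + rsum g.
Proof.
move=> f0 g0 sf sg; apply: EFin_inj.
rewrite EFinD !ge0_rsum//; last 2 first.
- by move=> x; rewrite addr_ge0.
- exact: absumD.
by rewrite -esumD// => x _; rewrite lee_fin.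
Qed.

Lemma rsumD {T : countType} (f g : T -> R) : absum f -> absum g ->
  rsum (fun x => f x + g x) = rsum f + rsum g.
Proof.
move=> sf sg; have [fp fn] := (absum_pos _ sf, absum_neg _ sf).
have [gp gn] := (absum_pos _ sg, absum_neg _ sg).
rewrite (@eq_rsum _ _ (fun x => (f^\+ x + g^\+ x) - (f^\- x + g^\- x))); last first.
  by move=> x; rewrite -[LHS]/((f + g) x) -funrDB.
rewrite ge0_rsumB//; last 4 first.
- by move=> x; rewrite addr_ge0.
- by move=> x; rewrite addr_ge0.
- exact: absumD.
- exact: absumD.
rewrite !ge0_rsumD// (rsum_posneg f)// (rsum_posneg g)//; ring.
Qed.

Lemma rsumN {T : countType} (f : T -> R) : absum f ->
  rsum (fun x => - f x) = - rsum f.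
Proof.
move=> sf; apply/eqP; rewrite -addr_eq0 -rsumD//; last exact: absumN.
by apply/eqP; rewrite -[RHS](@rsum0 T); apply: eq_rsum => x; rewrite addNr.
Qed.

Lemma rsumB {T : countType} (f g : T -> R) : absum f -> absum g ->
  rsum (fun x => f x - g x) = rsum f - rsum g.
Proof. by move=> sf sg; rewrite rsumD ?rsumN//; exact: absumN. Qed.

Lemma ge0_rsumZ {T : countType} (r : R) (f : T -> R) : 0 <= r ->
  (forall x, 0 <= f x) -> absum f -> rsum (fun x => r * f x) = r * rsum f.
Proof.
move=> r0 f0 sf; apply: EFin_inj; rewrite EFinM !ge0_rsum//.
- by rewrite esumZ.
- by move=> x; rewrite mulr_ge0.
- exact: absumZ.
Qed.

Lemma rsumZ {T : countType} (r : R) (f : T -> R) : absum f ->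
  rsum (fun x => r * f x) = r * rsum f.
Proof.
move=> sf.
wlog r0 : r / 0 <= r.
  move=> H; have [|r0] := leP 0 r; first exact: H.
  rewrite (@eq_rsum _ _ (fun x => - (- r * f x))); last by move=> x; ring.
  rewrite rsumN; last exact: absumZ.
  by rewrite H ?oppr_ge0 ?ltW// mulNr opprK.
rewrite (@eq_rsum _ _ (fun x => r * f^\+ x - r * f^\- x)); last first.
  by move=> x; rewrite -mulrBr -[in LHS](funrposBneg f).
have [fp fn] := (absum_pos _ sf, absum_neg _ sf).
by rewrite rsumB ?ge0_rsumZ ?(rsum_posneg f)// ?mulrBr//; exact: absumZ.
Qed.

Lemma ler_rsum {T : countType} (f g : T -> R) : absum f -> absum g ->
  (forall x, f x <= g x) -> rsum f <= rsum g.
Proof.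
move=> sf sg fg; rewrite -subr_ge0 -rsumB//.
by apply: rsum_ge0 => x; rewrite subr_ge0.
Qed.

Lemma ler_norm_rsum {T : countType} (f : T -> R) : absum f ->
  `|rsum f| <= rsum (fun x => `|f x|).
Proof.
move=> sf.
have sn : absum (fun x => `|f x|) by rewrite ge0_absum.
rewrite ler_norml -rsumN//; apply/andP; split; apply: ler_rsum => //.
- exact: absumN.
- by move=> x; rewrite lerNl -normrN ler_norm.
- by move=> x; exact: ler_norm.
Qed.

Lemma rsum_fset {T : countType} (A : seq T) (f : T -> R) : uniq A ->
  (forall x, x \notin A -> f x = 0) -> rsum f = \sum_(x <- A) f x.
Proof.
elim: A f => [|a A IH] f /=.
  move=> _ f0; rewrite big_nil -[RHS](@rsum0 T).
  by apply: eq_rsum => x; exact: f0.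
case/andP => aA uA f0.
have sfin (g : T -> R) : (forall x, x \notin a :: A -> g x = 0) -> absum g.
  move=> g0; apply: absum_fin; apply: (@sub_finite_set _ _ [set` a :: A]).
    by move=> x /= gx; apply/negPn/negP => /g0 /eqP; rewrite (negPf gx).
  exact: finite_seq.
(* Split off the head: [f1] lives on [a], and [f2] on [A], because [a] does not occur in [A]. *)
pose f1 x := if x == a then f a else 0.
pose f2 x := if x == a then 0 else f x.
rewrite (@eq_rsum _ _ (fun x => f1 x + f2 x)); last first.
  by move=> x; rewrite /f1 /f2; case: eqP => [->|]; rewrite ?addr0 ?add0r.
have E1 : rsum f1 = f a.
  (* A one-point family has a constant sign, so up to negation its sum is an [esum]. *)
  wlog fa : f f0 @f1 {f2} / 0 <= f a => [H|].
    have [|fa] := leP 0 (f a); first exact: H.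
    have := H (fun x => - f x).
    rewrite oppr_ge0 ltW// => /(_ _ isT) H1.
    rewrite (@eq_rsum _ _ (fun x => - (if x == a then - f a else 0))); last first.
      by move=> x; rewrite /f1; case: ifP; rewrite ?opprK ?oppr0.
    rewrite rsumN ?H1 ?opprK//; first by move=> x /f0 ->; rewrite oppr0.
    by apply: sfin => x; rewrite inE negb_or => /andP[/negPf -> _].
  apply: EFin_inj; rewrite ge0_rsum; last 2 first.
  - by move=> x; rewrite /f1; case: ifP.
  - by apply: sfin => x; rewrite /f1 inE negb_or => /andP[/negPf -> _].
  rewrite -(@esum_set1 _ _ a (fun x => (f x)%:E)) ?lee_fin//.
  rewrite [RHS]esum_mkcond; apply: eq_esum => x _; rewrite /f1 in_set1.
  by case: eqP => [->|].
have E2 : rsum f2 = \sum_(x <- A) f x.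
  rewrite (IH f2)//.
    apply: eq_big_seq => x xA; rewrite /f2.
    by case: eqP => // xa; rewrite xa (negPf aA) in xA.
  move=> x xA; rewrite /f2; case: eqP => // /eqP xa.
  by apply: f0; rewrite inE negb_or xa.
rewrite rsumD ?E1 ?E2 ?big_cons//; apply: sfin => x; rewrite /f1 /f2.
  by rewrite inE negb_or => /andP[/negPf ->].
by move=> xA; rewrite f0//; case: ifP.
Qed.

Lemma ler_rsum_term {T : countType} (f : T -> R) (a : T) :
  (forall x, 0 <= f x) -> absum f -> f a <= rsum f.
Proof.
move=> f0 sf.
have E := @rsum_fset _ [:: a] (fun x => if x == a then f a else 0) isT.
rewrite (_ : f a = rsum (fun x => if x == a then f a else 0)); last first.
  rewrite E; first by rewrite big_seq1 eqxx.
  by move=> x; rewrite inE => /negPf ->.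
apply: ler_rsum => //; last by move=> x; case: eqP => [->|].
apply: absum_le sf => x; case: eqP => [->|]; first by rewrite ger0_norm.
by rewrite normr0.
Qed.

Lemma rsum_eq0 {T : countType} (f : T -> R) :
  (forall x, 0 <= f x) -> absum f -> rsum f = 0 -> forall x, f x = 0.
Proof.
move=> f0 sf rf x; apply/eqP; rewrite eq_le f0 andbT -rf.
exact: ler_rsum_term.
Qed.

(** * Double sums: Tonelli and Fubini *)

Lemma absum_swap {S T : countType} (F : S * T -> R) :
  absum F -> absum (fun p : T * S => F (p.2, p.1)).
Proof.
apply: le_lt_trans.
rewrite -(@reindex_esum _ _ _ setT setT (fun p : T * S => (p.2, p.1)) (fun p => `|F p|%:E))//.
split => //; first by move=> [a b] [c d] _ _ /= [-> ->].
by move=> [s t] _; exists (t, s).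
Qed.

Lemma rsum_swap {S T : countType} (F : S * T -> R) :
  rsum (fun p : T * S => F (p.2, p.1)) = rsum F.
Proof.
have bij : set_bij setT setT (fun p : T * S => (p.2, p.1)).
  split => //; first by move=> [a b] [c d] _ _ /= [-> ->].
  by move=> [s t] _; exists (t, s).
rewrite /rsum /sgsum; congr (fine (_ - _)).
  by rewrite (reindex_esum _ _ _ (fun p => (F^\+ p)%:E) bij).
by rewrite (reindex_esum _ _ _ (fun p => (F^\- p)%:E) bij).
Qed.

Lemma esum_pair {S T : countType} (F : S * T -> R) : (forall p, 0 <= F p) ->
  (\esum_(p in [set: S * T]) (F p)%:E =
   \esum_(s in [set: S]) \esum_(t in [set: T]) (F (s, t))%:E)%E.
Proof.
move=> F0; rewrite (@esum_esum _ _ _ setT (fun=> setT) (fun s t => (F (s, t))%:E)); last first.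
  by move=> *; rewrite lee_fin.
rewrite (_ : _ `*`` _ = setT); last by apply/seteqP; split.
by apply: eq_esum => -[].
Qed.

(** Tonelli's criterion, which makes the double sums in [lapl_pairing] and [lapl_rgreen]
    converge. *)
Lemma absum_pair {S T : countType} (F : S * T -> R) :
  (forall s, absum (fun t => F (s, t))) ->
  absum (fun s => rsum (fun t => `|F (s, t)|)) -> absum F.
Proof.
move=> sF; rewrite /absum (esum_pair (fun p => `|F p|))//.
apply: le_lt_trans; apply: le_esum => s _.
rewrite ger0_norm ?rsum_ge0// ge0_rsum//.
by rewrite /absum; under eq_esum do rewrite normr_id; exact: sF.
Qed.

Lemma absum_slice {S T : countType} (F : S * T -> R) (s : S) :
  absum F -> absum (fun t => F (s, t)).
Proof.
rewrite /absum (esum_pair (fun p => `|F p|))//; apply: le_lt_trans.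
set h := fun s0 : S => (\esum_(t in [set: T]) `|F (s0, t)|%:E)%E.
have h0 s0 : (0 <= h s0)%E by apply: esum_ge0 => t _; rewrite lee_fin.
rewrite -[leLHS](esum_set1 (a := h) (h0 s)) esum_mkcond.
by apply: le_esum => s0 _; case: ifP => _; rewrite ?lexx ?h0.
Qed.

Lemma ge0_rsum_pair {S T : countType} (F : S * T -> R) :
  (forall p, 0 <= F p) -> absum F ->
  absum (fun s => rsum (fun t => F (s, t))) /\
  rsum F = rsum (fun s => rsum (fun t => F (s, t))).
Proof.
move=> F0 sF.
have r0 s : 0 <= rsum (fun t => F (s, t)) by apply: rsum_ge0.
have E : (\esum_(s in [set: S]) (rsum (fun t => F (s, t)))%:E = (rsum F)%:E)%E.
  rewrite ge0_rsum// esum_pair//; apply: eq_esum => s _.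
  by rewrite ge0_rsum//; exact: absum_slice.
have sr : absum (fun s => rsum (fun t => F (s, t))).
  by rewrite ge0_absum// E ltry.
by split => //; apply: EFin_inj; rewrite -E ge0_rsum.
Qed.

(** Tonelli for the positive and the negative part, then subtraction. *)
Lemma rsum_pair {S T : countType} (F : S * T -> R) : absum F ->
  rsum F = rsum (fun s => rsum (fun t => F (s, t))).
Proof.
move=> sF; have [sp sn] := (absum_pos _ sF, absum_neg _ sF).
have [rp Ep] := ge0_rsum_pair _ (funrpos_ge0 F) sp.
have [rn En] := ge0_rsum_pair _ (funrneg_ge0 F) sn.
rewrite rsum_posneg// Ep En -(rsumB _ _ rp rn); apply: eq_rsum => s.
rewrite -rsumB; [|exact: absum_slice|exact: absum_slice].
by apply: eq_rsum => t; rewrite -[in RHS](funrposBneg F).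
Qed.

Lemma rsum_exchange {S T : countType} (F : S * T -> R) : absum F ->
  rsum (fun s => rsum (fun t => F (s, t))) =
  rsum (fun t => rsum (fun s => F (s, t))).
Proof.
move=> sF; rewrite -rsum_pair// -rsum_swap rsum_pair//.
exact: absum_swap.
Qed.

End RealSums.

(** * The Laplacian and the energy form *)

Section WeightedGraph.
Context {R : realType} {X : countType} {b : X -> X -> R} {c : X -> R}.
Hypothesis hgraph : is_graph b c.

Let b_ge0 x y : 0 <= b x y. Proof. by case: hgraph. Qed.
Let b_sym x y : b x y = b y x. Proof. by case: hgraph. Qed.
Let c_ge0 x : 0 <= c x. Proof. by case: hgraph. Qed.

Lemma absum_weight x : absum (b x).
Proof. by rewrite ge0_absum//; case: hgraph. Qed.

Lemma calFP (f : X -> R) :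
  calF b f <-> forall x, absum (fun y => b x y * f y).
Proof.
have E x : (\esum_(y in [set: X]) `|b x y * f y|%:E =
            \esum_(y in [set: X]) (b x y * `|f y|)%:E)%E.
  by apply: eq_esum => y _; rewrite normrM ger0_norm.
by split => Ff x; [rewrite /absum E|rewrite -E]; exact: Ff.
Qed.

Lemma absum_calF (f : X -> R) x : calF b f -> absum (fun y => b x y * f y).
Proof. by move=> /calFP. Qed.

Lemma calF_cst a : calF b (fun=> a).
Proof.
apply/calFP => x; rewrite (_ : (fun y => _) = (fun y => a * b x y)).
  by apply: absumZ; exact: absum_weight.
by apply/funext => y; rewrite mulrC.
Qed.

Lemma calFD (f g : X -> R) : calF b f -> calF b g -> calF b (fun x => f x + g x).
Proof.
move=> /calFP Ff /calFP Fg; apply/calFP => x.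
under eq_fun do rewrite mulrDr; exact: absumD.
Qed.

Lemma calFZ r (f : X -> R) : calF b f -> calF b (fun x => r * f x).
Proof.
move=> /calFP Ff; apply/calFP => x.
under eq_fun do rewrite mulrCA; exact: absumZ.
Qed.

Lemma calFN (f : X -> R) : calF b f -> calF b (fun x => - f x).
Proof.
move=> /calFP Ff; apply/calFP => x.
under eq_fun do rewrite mulrN; exact: absumN.
Qed.

Lemma calFB (f g : X -> R) : calF b f -> calF b g -> calF b (fun x => f x - g x).
Proof. by move=> Ff Fg; apply: calFD => //; exact: calFN. Qed.

Lemma absum_diff (f : X -> R) x : calF b f ->
  absum (fun y => b x y * (f x - f y)).
Proof.
move=> /calFP Ff; under eq_fun do rewrite mulrBr mulrC.
by apply: absumB => //; apply: absumZ; exact: absum_weight.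
Qed.

(** Both [b x] and [b x * f] are summable, so the sum of differences may be split. In this form
    linearity in [f] is visible. *)
Lemma laplE (f : X -> R) x : calF b f -> lapl b c f x =
  rsum (b x) * f x - rsum (fun y => b x y * f y) + c x * f x.
Proof.
move=> /[dup] /calFP Ff cFf; congr (_ + _).
rewrite -/(rsum _) mulrC -rsumZ; last exact: absum_weight.
rewrite -rsumB//; last by apply: absumZ; exact: absum_weight.
by apply: eq_rsum => y; rewrite mulrBr mulrC.
Qed.

Lemma laplD (f g : X -> R) x : calF b f -> calF b g ->
  lapl b c (fun x => f x + g x) x = lapl b c f x + lapl b c g x.
Proof.
move=> Ff Fg; rewrite !laplE//; last exact: calFD.
have -> : rsum (fun y => b x y * (f y + g y)) =
    rsum (fun y => b x y * f y) + rsum (fun y => b x y * g y).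
  rewrite -rsumD; [|exact: absum_calF|exact: absum_calF].
  by apply: eq_rsum => y; rewrite mulrDr.
by ring.
Qed.

Lemma laplZ r (f : X -> R) x : calF b f ->
  lapl b c (fun x => r * f x) x = r * lapl b c f x.
Proof.
move=> Ff; rewrite !laplE//; last exact: calFZ.
have -> : rsum (fun y => b x y * (r * f y)) = r * rsum (fun y => b x y * f y).
  rewrite -rsumZ; last exact: absum_calF.
  by apply: eq_rsum => y; rewrite mulrCA.
by ring.
Qed.

Lemma laplN (f : X -> R) x : calF b f ->
  lapl b c (fun x => - f x) x = - lapl b c f x.
Proof.
move=> Ff; rewrite (_ : (fun y => - f y) = (fun y => -1 * f y)).
  by rewrite laplZ// mulN1r.
by apply/funext => y; rewrite mulN1r.
Qed.

Lemma laplB (f g : X -> R) x : calF b f -> calF b g ->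
  lapl b c (fun x => f x - g x) x = lapl b c f x - lapl b c g x.
Proof. by move=> Ff Fg; rewrite laplD ?laplN//; exact: calFN. Qed.

Lemma lapl_cst a x : lapl b c (fun=> a) x = c x * a.
Proof.
rewrite /lapl -/(rsum _) (@eq_rsum _ _ _ (fun=> 0)) ?rsum0 ?add0r// => y.
by rewrite subrr mulr0.
Qed.

(** * The energy and its elementary bounds *)

Definition edge_sq (f : X -> R) (p : X * X) : R :=
  b p.1 p.2 * (f p.1 - f p.2) ^+ 2.

Definition kill_sq (f : X -> R) (x : X) : R := c x * f x ^+ 2.

(* In [energy] the factor 1/2 also applies to the killing term, which only
   affects constants below. *)
Definition renergy (f : X -> R) : R :=
  2^-1 * (rsum (edge_sq f) + rsum (kill_sq f)).

Let edge_sq_ge0 f p : 0 <= edge_sq f p.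
Proof. by rewrite mulr_ge0// sqr_ge0. Qed.

Let kill_sq_ge0 f x : 0 <= kill_sq f x.
Proof. by rewrite mulr_ge0// sqr_ge0. Qed.

Lemma calDP (f : X -> R) :
  calD b c f <-> absum (edge_sq f) /\ absum (kill_sq f).
Proof.
rewrite !ge0_absum//.
have e0 : (0 <= \esum_(p in [set: X * X]) (edge_sq f p)%:E)%E.
  by apply: esum_ge0 => p _; rewrite lee_fin.
have k0 : (0 <= \esum_(x in [set: X]) (kill_sq f x)%:E)%E.
  by apply: esum_ge0 => p _; rewrite lee_fin.
rewrite /calD /mkset /energy; split => [fD|[ef kf]]; last first.
  by rewrite lte_mul_pinfty// ?lee_fin// lte_add_pinfty.
have {}fD : (\esum_(p in [set: X * X]) (edge_sq f p)%:E +
            \esum_(x in [set: X]) (kill_sq f x)%:E < +oo)%E.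
  rewrite (_ : (_ + _)%E = (2%:E * ((2^-1)%:E * (
     \esum_(p in [set: X * X]) (edge_sq f p)%:E +
     \esum_(x in [set: X]) (kill_sq f x)%:E)))%E); last first.
    by rewrite muleA -EFinM divff// mul1e.
  by rewrite lte_mul_pinfty// ?lee_fin.
by split; apply: le_lt_trans fD; rewrite ?leeDr ?leeDl.
Qed.

Lemma energyE (f : X -> R) : calD b c f -> energy b c f = (renergy f)%:E.
Proof.
move=> /calDP[ef kf].
by rewrite /energy /renergy EFinM EFinD !ge0_rsum.
Qed.

Lemma renergy_ge0 f : 0 <= renergy f.
Proof. by rewrite mulr_ge0 ?addr_ge0 ?rsum_ge0. Qed.

(** Termwise (p+q)^2 <= 2p^2 + 2q^2, the gap being (p-q)^2. The factor 2 is harmless because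
    energies only have to be made small. *)
Lemma energy_sqD (f g : X -> R) : calD b c f -> calD b c g ->
  calD b c (fun x => f x + g x) /\
  renergy (fun x => f x + g x) <= 2 * renergy f + 2 * renergy g.
Proof.
move=> /calDP[ef kf] /calDP[eg kg].
have ee p : edge_sq (fun x => f x + g x) p <= 2 * edge_sq f p + 2 * edge_sq g p.
  rewrite /edge_sq; have := b_ge0 p.1 p.2.
  set B := b _ _; set f1 := f _; set f2 := f _; set g1 := g _; set g2 := g _.
  move=> B0; rewrite -subr_ge0.
  rewrite (_ : _ - _ = B * ((f1 - f2) - (g1 - g2)) ^+ 2); last by ring.
  by rewrite mulr_ge0// sqr_ge0.
have kk p : kill_sq (fun x => f x + g x) p <= 2 * kill_sq f p + 2 * kill_sq g p.
  rewrite /kill_sq -subr_ge0.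
  rewrite (_ : _ - _ = c p * (f p - g p) ^+ 2); last by ring.
  by rewrite mulr_ge0// sqr_ge0.
have see : absum (fun p => 2 * edge_sq f p + 2 * edge_sq g p).
  by apply: absumD; exact: absumZ.
have skk : absum (fun p => 2 * kill_sq f p + 2 * kill_sq g p).
  by apply: absumD; exact: absumZ.
have se : absum (edge_sq (fun x => f x + g x)).
  by apply: absum_le see => p; rewrite ger0_norm.
have sk : absum (kill_sq (fun x => f x + g x)).
  by apply: absum_le skk => p; rewrite ger0_norm.
split; first exact/calDP.
have := ler_rsum _ _ se see ee.
have := ler_rsum _ _ sk skk kk.
rewrite !rsumD ?rsumZ//; try exact: absumZ.
rewrite /renergy; lra.
Qed.

Lemma energyZ r (f : X -> R) : calD b c f ->
  calD b c (fun x => r * f x) /\ renergy (fun x => r * f x) = r ^+ 2 * renergy f.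
Proof.
move=> /calDP[ef kf].
have ee : edge_sq (fun x => r * f x) = (fun p => r ^+ 2 * edge_sq f p).
  by apply/funext => p; rewrite /edge_sq; ring.
have kk : kill_sq (fun x => r * f x) = (fun p => r ^+ 2 * kill_sq f p).
  by apply/funext => p; rewrite /kill_sq; ring.
split; first by apply/calDP; rewrite ee kk; split; exact: absumZ.
rewrite /renergy ee kk !rsumZ//; ring.
Qed.

(** A single term is at most the whole sum; the constant 2 cancels the factor 1/2 in [renergy]. *)
Lemma edge_sq_le (f : X -> R) x y : calD b c f ->
  b x y * (f x - f y) ^+ 2 <= 2 * renergy f.
Proof.
move=> /calDP[ef kf].
have : b x y * (f x - f y) ^+ 2 <= rsum (edge_sq f).
  exact: (@ler_rsum_term _ _ _ (x, y) (edge_sq_ge0 f) ef).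
have := rsum_ge0 _ (kill_sq_ge0 f).
rewrite /renergy; lra.
Qed.

Lemma kill_sq_le (f : X -> R) x : calD b c f -> c x * f x ^+ 2 <= 2 * renergy f.
Proof.
move=> /calDP[ef kf].
have : c x * f x ^+ 2 <= rsum (kill_sq f).
  exact: (@ler_rsum_term _ _ _ x (kill_sq_ge0 f) kf).
have := rsum_ge0 _ (edge_sq_ge0 f).
rewrite /renergy; lra.
Qed.

(** * The comparison principle *)

(** Green's formula before symmetrization. Finite support of [v] makes the outer sum finite, and [D]
    in F makes each inner sum absolutely convergent, so Fubini applies. *)
Lemma lapl_pairing (v D : X -> R) : finite_set [set x | v x != 0] -> calF b D ->
  absum (fun p => b p.1 p.2 * (v p.1 * (D p.1 - D p.2))) /\
  rsum (fun x => v x * lapl b c D x) =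
    rsum (fun p => b p.1 p.2 * (v p.1 * (D p.1 - D p.2))) +
    rsum (fun x => c x * (v x * D x)).
Proof.
move=> finv FD; set T := fun p : X * X => _.
have TE x : (fun y => T (x, y)) = (fun y => v x * (b x y * (D x - D y))).
  by apply/funext => y; rewrite /T /=; ring.
have finsupp (g : X -> R) : (forall x, v x = 0 -> g x = 0) -> absum g.
  move=> g0; apply: absum_fin; apply: sub_finite_set finv => x /=.
  by apply: contra => /eqP /g0 ->.
have sT : absum T.
  apply: absum_pair => [s|].
    by rewrite TE; apply: absumZ; exact: absum_diff.
  apply: finsupp => x vx; rewrite -[RHS](@rsum0 R X); apply: eq_rsum => y.
  by rewrite /T /= vx mul0r mulr0 normr0.
split=> //; rewrite rsum_pair// -rsumD; last 2 first.
- apply: finsupp => x vx; rewrite TE rsumZ ?vx ?mul0r//; exact: absum_diff.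
- by apply: finsupp => x vx; rewrite vx mul0r mulr0.
apply: eq_rsum => x; rewrite TE rsumZ; last exact: absum_diff.
by rewrite /lapl -/(rsum _); ring.
Qed.

(* With [h = phi - g] and [D = g - s], so that [v] is the positive part of
   [h + D], testing [L D <= 0] against [v] bounds the energy of [v] by that
   of [h]. *)
Lemma renergy_truncation (phi g s : X -> R) :
  finite_set [set x | phi x != 0] -> calF b g -> calF b s ->
  (forall x, 0 <= s x) -> (forall x, lapl b c g x <= lapl b c s x) ->
  calD b c (fun x => phi x - g x) ->
  let v x := Num.max (phi x - s x) 0 in
  [/\ finite_set [set x | v x != 0], calD b c v &
      renergy v <= 2 * renergy (fun x => phi x - g x)].
Proof.
move=> finphi Fg Fs s0 gs /calDP; set h := (fun x => phi x - g x) => -[eh kh] v.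
have v0 x : 0 <= v x by rewrite /v le_max lexx orbT.
(* Since [s >= 0], [v] vanishes wherever [phi] does. *)
have finv : finite_set [set x | v x != 0].
  apply: sub_finite_set finphi => x /=; apply: contra => /eqP phix.
  by rewrite /v phix sub0r; apply/eqP/max_idPr; rewrite oppr_le0.
pose D x := g x - s x.
have FD : calF b D by exact: calFB.
have [sT ET] := lapl_pairing v D finv FD.
set T := fun p : X * X => _ in sT ET.
(* Swapping the endpoints symmetrizes: [T + T'] is b(x,y) (v x - v y) (D x - D y), by symmetry of
   b. *)
pose T' (p : X * X) := T (p.2, p.1).
have sT' : absum T' by exact: absum_swap.
have skvD : absum (fun x => c x * (v x * D x)).
  apply: absum_fin; apply: sub_finite_set finv => x /=.
  by apply: contra => /eqP ->; rewrite mul0r mulr0.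
have test : rsum T + rsum (fun x => c x * (v x * D x)) <= 0.
  rewrite -ET -oppr_ge0 -rsumN; last first.
    apply: absum_fin; apply: sub_finite_set finv => x /=.
    by apply: contra => /eqP ->; rewrite mul0r.
  apply: rsum_ge0 => x; rewrite -mulrN mulr_ge0//.
  rewrite oppr_ge0 laplB//.
  by rewrite subr_le0.
have ve x : v x = 0 /\ h x + D x <= 0 \/ v x = h x + D x /\ 0 <= h x + D x.
  have -> : h x + D x = phi x - s x by rewrite /h /D; ring.
  rewrite /v; case: (leP (phi x - s x) 0) => ?; [left|right] => //.
  by split=> //; exact: ltW.
(* Write a, d, e for the increments of [v], [D], [h]. Then a^2 <= a(d+e) and ae <= (a^2+e^2)/2 give
   a^2/2 <= ad + e^2/2. *)
have edge p : 2^-1 * edge_sq v p <= T p + T' p + 2^-1 * edge_sq h p.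
  rewrite /T' /T /edge_sq [b p.2 p.1]b_sym /=; case: p => x y /=.
  have := b_ge0 x y; set B := b x y => B0.
  rewrite -subr_ge0 (_ : _ - _ = B * ((v x - v y) * (D x - D y)
     + 2^-1 * (h x - h y) ^+ 2 - 2^-1 * (v x - v y) ^+ 2)); last by ring.
  apply: mulr_ge0 => //.
  have sq := sqr_ge0 ((v x - v y) - (h x - h y)).
  (* Taking positive parts is monotone and 1-Lipschitz, so the increment of [v] lies between 0 and
     that of [h + D]. *)
  have key : 0 <= (v x - v y) * ((h x + D x) - (h y + D y) - (v x - v y)).
    by case: (ve x) => -[-> ?]; case: (ve y) => -[-> ?]; nra.
  nra.
(* The same argument with values in place of increments, using v^2 = v(h+D). *)
have kill x : 2^-1 * kill_sq v x <= c x * (v x * D x) + 2^-1 * kill_sq h x.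
  rewrite /kill_sq -subr_ge0 (_ : _ - _ = c x * (v x * D x
     + 2^-1 * h x ^+ 2 - 2^-1 * v x ^+ 2)); last by ring.
  apply: mulr_ge0 => //.
  have sq := sqr_ge0 (v x - h x).
  by case: (ve x) => -[E ?]; rewrite E in sq *; nra.
have sev' : absum (fun p => 2^-1 * edge_sq v p).
  apply: (@absum_le _ _ _ (fun p => T p + T' p + 2^-1 * edge_sq h p)) => [p|].
    by rewrite ger0_norm// mulr_ge0.
  by apply: absumD; [exact: absumD|exact: absumZ].
have sev : absum (edge_sq v).
  rewrite (_ : edge_sq v = (fun p => 2 * (2^-1 * edge_sq v p))).
    exact: absumZ.
  by apply/funext => p; rewrite mulrA divff// mul1r.
have skv : absum (kill_sq v).
  apply: absum_fin; apply: sub_finite_set finv => x /=.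
  by apply: contra => /eqP vx; rewrite /kill_sq vx expr0n mulr0.
split=> //; first exact/calDP.
have Ee : 2^-1 * rsum (edge_sq v) <= rsum T + rsum T + 2^-1 * rsum (edge_sq h).
  rewrite -{2}(rsum_swap T) -!rsumZ// -rsumD// -rsumD; last 2 first.
  - exact: absumD.
  - exact: absumZ.
  by apply: ler_rsum => //; apply: absumD; [exact: absumD|exact: absumZ].
have Ek : 2^-1 * rsum (kill_sq v) <=
    rsum (fun x => c x * (v x * D x)) + 2^-1 * rsum (kill_sq h).
  rewrite -!rsumZ// -rsumD//; last exact: absumZ.
  by apply: ler_rsum => //; [exact: absumZ|apply: absumD => //; exact: absumZ].
(* Adding [Ee] to twice [Ek] produces 2 times the left side of [test], which is at most 0. The edge
   and killing sums then carry the weights 1/2 and 1, hence the factor 2 in the conclusion. *)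
have := rsum_ge0 _ (edge_sq_ge0 h).
have := rsum_ge0 _ (kill_sq_ge0 h).
have := rsum_ge0 _ (kill_sq_ge0 v).
rewrite /renergy -/h; move: test Ee Ek.
move: (rsum (edge_sq v)) (rsum (edge_sq h)) (rsum (kill_sq v)) (rsum (kill_sq h)).
move: (rsum T) (rsum (fun x => c x * (v x * D x))) => r1 r2 r3 r4 r5 r6.
lra.
Qed.

(** * The space D_0 *)

Lemma calDB (f g : X -> R) : calD b c f -> calD b c g ->
  calD b c (fun x => f x - g x).
Proof.
move=> Df /(energyZ (-1))[Dg _].
rewrite (_ : (fun _ => _) = (fun x => f x + -1 * g x)).
  by have [] := energy_sqD _ _ Df Dg.
by apply/funext => x; rewrite mulN1r.
Qed.

(** Separating the energy error from the error at [o] removes the square roots from all later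
    estimates. *)
Lemma calD0P (o : X) (f : X -> R) : calD0 b c o f <->
  calD b c f /\ forall e, 0 < e -> exists phi : X -> R,
    [/\ finite_set [set x | phi x != 0], calD b c phi,
        renergy (fun x => f x - phi x) <= e & (f o - phi o) ^+ 2 <= e].
Proof.
have E phi : calD b c f -> calD b c phi -> onorm b c o (f \- phi) =
    Num.sqrt (renergy (fun x => f x - phi x) + (f o - phi o) ^+ 2).
  move=> Df Dphi; rewrite /onorm -/(fun x => f x - phi x).
  by rewrite energyE/= ?real_normK ?num_real//; exact: calDB.
split=> -[Df H]; split=> // e e0.
  have [|phi [finphi Dphi]] := H (Num.sqrt e); first by rewrite sqrtr_gt0.
  rewrite E// ltr_sqrt// => /ltW le_e; exists phi; split => //.
    by apply: le_trans le_e; rewrite lerDl sqr_ge0.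
  by apply: le_trans le_e; rewrite lerDr renergy_ge0.
(* The two errors add up to at most e^2/2, strictly below e^2. *)
have [|phi [finphi Dphi h1 h2]] := H (e ^+ 2 / 4).
  by rewrite divr_gt0// exprn_gt0.
exists phi; split => //; rewrite E//.
rewrite -[ltRHS]ger0_norm ?ltW// -sqrtr_sqr ltr_sqrt ?exprn_gt0//.
have : 0 < e ^+ 2 by rewrite exprn_gt0.
move: h1 h2; set r := renergy _; set q := (f o - phi o) ^+ 2.
by set u := e ^+ 2 => *; lra.
Qed.

Lemma calD0D (o : X) (f g : X -> R) : calD0 b c o f -> calD0 b c o g ->
  calD0 b c o (fun x => f x + g x).
Proof.
move=> /calD0P[Df Hf] /calD0P[Dg Hg]; apply/calD0P.
have [Dfg _] := energy_sqD _ _ Df Dg; split=> // e e0.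
(* The bound of [energy_sqD] doubles each error, and 2(e/4) + 2(e/4) = e. *)
have [|phi [fin1 D1 e1 o1]] := Hf (e / 4); first by rewrite divr_gt0.
have [|psi [fin2 D2 e2 o2]] := Hg (e / 4); first by rewrite divr_gt0.
have [Dpp _] := energy_sqD _ _ D1 D2.
exists (fun x => phi x + psi x).
have finS : finite_set [set x | phi x + psi x != 0].
  apply: (@sub_finite_set _ _ ([set x | phi x != 0] `|` [set x | psi x != 0])).
    move=> x /= pp; apply/orP; apply: contraNT pp.
    by rewrite negb_or !negbK => /andP[/eqP -> /eqP ->]; rewrite addr0.
  by rewrite finite_setU.
split => //.
  have [_] := energy_sqD _ _ (calDB _ _ Df D1) (calDB _ _ Dg D2).
  rewrite (_ : (fun x => f x - phi x + (g x - psi x)) =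
               (fun x => f x + g x - (phi x + psi x))); last first.
    by apply/funext => x; ring.
  by move=> /le_trans; apply; lra.
have := sqr_ge0 ((f o - phi o) - (g o - psi o)); nra.
Qed.

Lemma calD0Z (o : X) r (f : X -> R) : calD0 b c o f ->
  calD0 b c o (fun x => r * f x).
Proof.
move=> /calD0P[Df Hf]; apply/calD0P.
have [Drf _] := energyZ r _ Df; split => // e e0.
have r0 : 0 < r ^+ 2 + 1 by rewrite ltr_wpDl// sqr_ge0.
(* Adding 1 keeps the divisor positive when r = 0. *)
have [|phi [fin1 D1 e1 o1]] := Hf (e / (r ^+ 2 + 1)); first by rewrite divr_gt0.
have small q : 0 <= q -> q <= e / (r ^+ 2 + 1) -> r ^+ 2 * q <= e.
  move=> q0; rewrite ler_pdivlMr// => qe; apply: le_trans qe.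
  by rewrite mulrC ler_wpM2l// lerDl.
have [Drphi _] := energyZ r _ D1.
exists (fun x => r * phi x); split => //.
- apply: sub_finite_set fin1 => x /=; apply: contra => /eqP ->.
  by rewrite mulr0.
- rewrite (_ : (fun _ => _) = (fun x => r * (f x - phi x))); last first.
    by apply/funext => x; rewrite mulrBr.
  have [_ ->] : calD b c (fun x => r * (f x - phi x)) /\
      renergy (fun x => r * (f x - phi x)) =
      r ^+ 2 * renergy (fun x => f x - phi x).
    by apply: energyZ; exact: calDB.
  by apply: small => //; exact: renergy_ge0.
- by rewrite -mulrBr exprMn small// sqr_ge0.
Qed.

(** Along a path of positive weights each edge bounds its own increment by the energy, and (p+q)^2
    <= 2p^2 + 2q^2 chains the bounds. As C does not depend on [f], small energy and a small value at
    one vertex force small values at every vertex. *)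
Lemma oscillation_bound : connected_graph b -> forall x y, exists2 C : R,
  0 <= C & forall f, calD b c f -> (f x - f y) ^+ 2 <= C * renergy f.
Proof.
move=> hconn x y; have [p [+ <-]] := hconn x y.
elim: p x => [|z p IH] x /=.
  by move=> _; exists 0 => // f _; rewrite subrr expr0n mul0r.
move=> /andP[bxz /IH[C C0 HC]].
exists (2 * (2 / b x z) + 2 * C) => [|f Df].
  by rewrite addr_ge0// ?mulr_ge0// invr_ge0.
have h1 : (f x - f z) ^+ 2 <= 2 / b x z * renergy f.
  by rewrite mulrAC ler_pdivlMr// mulrC (edge_sq_le).
have h2 := HC _ Df.
have := sqr_ge0 ((f x - f z) - (f z - f (last z p))).
move: h1 h2; set r := renergy f; set k := 2 / _; nra.
Qed.

Lemma sqr_max0B_le (p q : R) : (Num.max p 0 - Num.max q 0) ^+ 2 <= (p - q) ^+ 2.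
Proof.
have := sqr_ge0 (p - q); have := sqr_ge0 p; have := sqr_ge0 q.
by case: (leP p 0) => ?; case: (leP q 0) => ?; nra.
Qed.

Lemma le0_of_le_small (K a : R) : 0 <= K -> (forall e, 0 < e -> a <= K * e) -> a <= 0.
Proof.
move=> K0 H; rewrite leNgt; apply/negP => a0.
(* With this choice K e is less than a. *)
have := H (a / (2 * (K + 1))); rewrite divr_gt0 ?mulr_gt0 ?ltr_wpDl// => /(_ isT).
apply/negP; rewrite -ltNge mulrA ltr_pdivrMr ?mulr_gt0 ?ltr_wpDl//; nra.
Qed.

(** * Comparison for functions in D_0 on a connected graph *)

Context {o : X}.
Hypothesis hconn : connected_graph b.

(** Such a constant is harmonic, so adding it to the Green function at [o] gives another solution;
    uniqueness forces it to be 0. *)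
Lemma calD0_cst_eq0 (a : R) : (exists! g, is_green b c o o g) ->
  (forall x, c x * a = 0) -> calD0 b c o (fun=> a) -> a = 0.
Proof.
move=> [g [[D0g Fg Lg] uniq_g]] ca D0a.
have gga : is_green b c o o (fun x => g x + a).
  have Fa : calF b (fun=> a) by exact: calF_cst.
  split=> [||x]; [exact: calD0D|exact: calFD|].
  by rewrite laplD// lapl_cst ca addr0 Lg.
have /(congr1 (fun f => f o)) /eqP := uniq_g _ gga.
by rewrite -subr_eq0 opprD addrA subrr add0r oppr_eq0 => /eqP.
Qed.

(* The positive part of [g - s] is approximated in energy by finitely supported
   functions of vanishing energy: it is a constant in [calD0], hence 0 by
   uniqueness of the Green function. *)
Lemma calD0_comparison (g s : X -> R) : (exists! g, is_green b c o o g) ->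
  calD0 b c o g -> calF b g -> calF b s -> (forall x, 0 <= s x) ->
  (forall x, lapl b c g x <= lapl b c s x) -> forall x, g x <= s x.
Proof.
move=> huniq /calD0P[Dg Hg] Fg Fs s0 gs.
pose v x := Num.max (g x - s x) 0.
(* The witness is the positive part of [phi - s], with [phi] close to [g]. Leaving C free lets the
   last clause serve every x, including x = o with C = 0. *)
have approx e : 0 < e -> exists w : X -> R,
    [/\ finite_set [set x | w x != 0], calD b c w, renergy w <= 2 * e &
      forall x C, 0 <= C ->
      (forall f, calD b c f -> (f x - f o) ^+ 2 <= C * renergy f) ->
      (v x - w x) ^+ 2 <= (2 * C + 2) * e].
  move=> e0; have [phi [finphi Dphi ee eo]] := Hg _ e0.
  have Dh := calDB _ _ Dg Dphi.
  have [Dh' Eh'] := energyZ (-1) _ Dh.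
  have hE : (fun x => -1 * (g x - phi x)) = (fun x => phi x - g x).
    by apply/funext => x; ring.
  rewrite hE in Dh' Eh'; rewrite sqrrN expr1n mul1r in Eh'.
  have [finw Dw Ew] := renergy_truncation _ _ _ finphi Fg Fs s0 gs Dh'.
  exists (fun x => Num.max (phi x - s x) 0); split => //.
    by apply: (le_trans Ew); rewrite Eh' ler_wpM2l.
  move=> x C C0 /(_ _ Dh) HC.
  have h1 : (v x - Num.max (phi x - s x) 0) ^+ 2 <= (g x - phi x) ^+ 2.
    rewrite (_ : g x - phi x = (g x - s x) - (phi x - s x)); last by ring.
    exact: sqr_max0B_le.
  apply: (le_trans h1).
  (* This square encodes p^2 <= 2(p-q)^2 + 2q^2, where p and q are the errors of [phi] at x and at
     o. *)
  have := sqr_ge0 ((g x - phi x) - (g o - phi o) - (g o - phi o)).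
  have h2 : C * renergy (fun x => g x - phi x) <= C * e by rewrite ler_wpM2l.
  nra.
have vconst x : v x = v o.
  have [C C0 HC] := oscillation_bound hconn x o.
  apply/eqP; rewrite -subr_eq0 -sqrf_eq0 eq_le sqr_ge0 andbT.
  (* The difference [v x - v o] splits into three errors whose squares sum to at most (2C+2)e + 2Ce
     + 2e; the 3 comes from squaring a sum of three terms. *)
  apply: (@le0_of_le_small (3 * (4 * C + 4))) => [|e e0].
    by rewrite mulr_ge0// addr_ge0// mulr_ge0.
  have [w [_ Dw Ew Hw]] := approx _ e0.
  have h1 := Hw x C C0 HC.
  have h2 : (v o - w o) ^+ 2 <= (2 * 0 + 2) * e.
    by apply: Hw => // f _; rewrite subrr expr0n mul0r.
  have h3 : (w x - w o) ^+ 2 <= C * (2 * e).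
    by apply: (le_trans (HC _ Dw)); rewrite ler_wpM2l.
  have -> : v x - v o = (v x - w x) + (w x - w o) - (v o - w o) by ring.
  move: h1 h2 h3; move: (v x - w x) (w x - w o) (v o - w o) => p q r.
  have := sqr_ge0 (p - q); have := sqr_ge0 (p + r); have := sqr_ge0 (q + r).
  nra.
have v0 x : 0 <= v x by rewrite /v le_max lexx orbT.
have cv x : c x * v x = 0.
  have [C C0 HC] := oscillation_bound hconn x o.
  suff : c x * v x ^+ 2 <= 0.
    have := c_ge0 x; rewrite le0r => /orP[/eqP -> _|cx]; first by rewrite mul0r.
    rewrite pmulr_rle0// => h; have : v x ^+ 2 == 0 by rewrite eq_le h sqr_ge0.
    by rewrite sqrf_eq0 => /eqP ->; rewrite mulr0.
  (* From v^2 <= 2(v-w)^2 + 2w^2: the first part gives 2c(2C+2)e, and the killing energy of [w]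
     gives 2 * 4e. *)
  apply: (@le0_of_le_small (2 * (c x * (2 * C + 2)) + 8)) => [|e e0].
    by rewrite addr_ge0// !mulr_ge0// addr_ge0// mulr_ge0.
  have [w [_ Dw Ew Hw]] := approx _ e0.
  have h1 := Hw x C C0 HC.
  have h2 := kill_sq_le _ x Dw.
  have h3 : c x * (v x - w x) ^+ 2 <= c x * ((2 * C + 2) * e).
    by rewrite ler_wpM2l.
  have h4 : 0 <= c x * ((v x - w x) - w x) ^+ 2 by rewrite mulr_ge0// sqr_ge0.
  nra.
have vo : v o = 0.
  (* The constant [v o] has no edge energy, and no killing energy by [cv]. Hence [v o - w] has the
     same energy as [w], and the approximants [w] place the constant in D_0. *)
  apply: calD0_cst_eq0 => // [x|]; first by rewrite -(vconst x).
  apply/calD0P.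
  have e0 (w : X -> R) : edge_sq (fun x => v o - w x) = edge_sq w.
    by apply/funext => p; rewrite /edge_sq; ring.
  have k0 (w : X -> R) : kill_sq (fun x => v o - w x) = kill_sq w.
    apply/funext => x; rewrite /kill_sq.
    rewrite (_ : _ * _ = c x * v o * (v o - 2 * w x) + c x * w x ^+ 2); last by ring.
    by rewrite -{1}(vconst x) cv mul0r add0r.
  have D0 : calD b c (fun _ : X => 0).
    apply/calDP; rewrite (_ : edge_sq _ = fun=> 0).
      rewrite (_ : kill_sq _ = fun=> 0); first by split; exact: absum0.
      by apply/funext => x; rewrite /kill_sq expr0n mulr0.
    by apply/funext => x; rewrite /edge_sq subrr expr0n mulr0.
  split.
    move/calDP: D0; rewrite -e0 -k0 => /calDP.
    by under eq_fun do rewrite subr0.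
  move=> e e_gt0; have [|w [finw Dw Ew Hw]] := approx (e / 2); first by rewrite divr_gt0.
  exists w; split => //.
    rewrite /renergy e0 k0 -/(renergy w); apply: (le_trans Ew); lra.
  have : (v o - w o) ^+ 2 <= (2 * 0 + 2) * (e / 2).
    by apply: Hw => // f _; rewrite subrr expr0n mul0r.
  lra.
move=> x; rewrite -subr_le0; apply: (@le_trans _ _ (v x)).
  by rewrite /v le_max lexx.
by rewrite vconst vo.
Qed.

(** * The Green operator *)

Hypothesis htrans : transient b c o.
Local Notation G := (green b c o).

Lemma greenP y : is_green b c o y (fun x => G x y).
Proof.
have [g [hg _]] := htrans y.
exact: (@xgetPex _ (fun=> 0) [set g | is_green b c o y g] (ex_intro _ g hg)).
Qed.

Lemma calF_green y : calF b (fun x => G x y). Proof. by case: (greenP y). Qed.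

(** Compare -G(., y), whose Laplacian is at most 0, with s = 0. *)
Lemma green_ge0 x y : 0 <= G x y.
Proof.
have [D0 F L] := greenP y.
rewrite -oppr_le0 -mulN1r; apply: (calD0_comparison (fun x => -1 * G x y) (fun=> 0)).
- exact: htrans.
- exact: calD0Z.
- exact: calFZ.
- exact: calF_cst.
- by [].
- by move=> z; rewrite lapl_cst mulr0 laplZ// L mulN1r oppr_le0 indicE.
Qed.

(** Finite partial sums of Gk lie in D_0, where the comparison principle applies. *)
Lemma lapl_green_sum (A : seq X) (k : X -> R) :
  let g x := \sum_(y <- A) k y * G x y in
  [/\ calD0 b c o g, calF b g &
      forall x, lapl b c g x = \sum_(y <- A) k y * \1_[set y] x].
Proof.
elim: A => [|a A [D0 F L]] /=.
  (* The zero function is placed in D_0 as 0 times a Green function. *)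
  have [D0 _ _] := greenP o.
  split=> [||x].
  - rewrite (_ : (fun x => _) = (fun x => 0 * G x o)); first exact: calD0Z.
    by apply/funext => x; rewrite big_nil mul0r.
  - by under eq_fun do rewrite big_nil; exact: calF_cst.
  - rewrite (_ : (fun x => _) = fun=> 0) ?lapl_cst ?mulr0 ?big_nil//.
    by apply/funext => z; rewrite big_nil.
have [D0a Fa La] := greenP a.
rewrite (_ : (fun x => _) = (fun x => k a * G x a + \sum_(y <- A) k y * G x y)); last first.
  by apply/funext => x; rewrite big_cons.
have Fka := calFZ (k a) _ Fa.
split=> [||x]; [|exact: calFD|].
  by apply: calD0D => //; exact: calD0Z.
by rewrite laplD// laplZ// La L big_cons.
Qed.

(** The sum is a supremum over finite sets A, and each partial sum has Laplacian k 1_A <= k <= L s,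
    so it stays below [s] by comparison. *)
Lemma green_minimal (k s : X -> R) : calF b s -> (forall x, 0 <= s x) ->
  (forall x, 0 <= k x) -> (forall x, k x <= lapl b c s x) ->
  forall x, (\esum_(y in [set: X]) (G x y * k y)%:E <= (s x)%:E)%E.
Proof.
move=> Fs s0 k0 ks x; apply: ge_ereal_sup => _ [A [finA _] <-].
rewrite fsbig_finite//= sumEFin lee_fin.
have : uniq (finmap.enum_fset (fset_set A)) by exact: finmap.fset_uniq.
move: (finmap.enum_fset _) => {finA}A uA.
have [D0 F L] := lapl_green_sum A k.
rewrite (_ : \sum_(_ <- _) _ = \sum_(y <- A) k y * G x y); last first.
  by apply: eq_bigr => y _; rewrite mulrC.
move: x; apply: calD0_comparison => // x; rewrite L.
apply: le_trans (ks x).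
rewrite (_ : \sum_(_ <- _) _ = \sum_(y <- A) (if y == x then k x else 0)); last first.
  apply: eq_bigr => y _; rewrite indicE; case: eqP => [->|yx].
    by rewrite mem_set// mulr1.
  by rewrite memNset ?mulr0//= => xy; apply: yx.
have [xA|xA] := boolP (x \in A).
  by rewrite (bigD1_seq x)//= eqxx big1 ?addr0// => y /negPf ->.
by rewrite big_seq big1// => y yA; case: eqP => // yx; rewrite -yx yA in xA.
Qed.

(** The equation L G_z = 1_z solved for its nonlocal part. *)
Lemma weighted_green_sum x z : rsum (fun y => b x y * G y z) =
  (rsum (b x) + c x) * G x z - \1_[set z] x.
Proof.
have [_ F L] := greenP z.
by rewrite -L laplE//; ring.
Qed.

Lemma calGP (k : X -> R) :
  calG b c o k <-> forall x, absum (fun y => G x y * k y).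
Proof.
have E x : (\esum_(y in [set: X]) `|G x y * k y|%:E =
            \esum_(y in [set: X]) (G x y * `|k y|)%:E)%E.
  by apply: eq_esum => y _; rewrite normrM ger0_norm// green_ge0.
by split => Gk x; [rewrite /absum E|rewrite -E]; exact: Gk.
Qed.

Definition rgreen (k : X -> R) (x : X) : R := rsum (fun y => G x y * k y).

Lemma green_opE (k : X -> R) x : calG b c o k ->
  green_op b c o k x = (rgreen k x)%:E.
Proof. by move=> /calGP Gk; rewrite -sgsum_rsum. Qed.

(** Fubini for b(x,y) G(y,z) k(z): summing over y first reduces the claim to L G_z = 1_z. *)
Lemma lapl_rgreen (k : X -> R) : calG b c o k ->
  calF b (rgreen k) /\ forall x, lapl b c (rgreen k) x = k x.
Proof.
move=> /calGP Gk.
pose F x (p : X * X) := b x p.2 * (G p.2 p.1 * k p.1).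
have FE x z : (fun y => F x (z, y)) = (fun y => k z * (b x y * G y z)).
  by apply/funext => y; rewrite /F /=; ring.
have sFz x z : absum (fun y => F x (z, y)).
  by rewrite FE; apply: absumZ; apply: absum_calF; exact: calF_green.
have sF x : absum (F x).
  apply: absum_pair => //.
  (* The sum over y of the absolute values is |k(z)| times [weighted_green_sum]; dropping the
     indicator leaves a multiple of G(x,z)|k(z)|, summable as k is in the domain of G. *)
  apply: (@absum_le _ _ _ (fun z => (rsum (b x) + c x) * `|G x z * k z|)).
    move=> z; rewrite ger0_norm ?rsum_ge0//.
    rewrite (_ : (fun y => `|F x (z, y)|) = fun y => `|k z| * (b x y * G y z)).
      rewrite rsumZ; last by apply: absum_calF; exact: calF_green.
      rewrite weighted_green_sum normrM (ger0_norm (green_ge0 _ _)).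
      rewrite mulrA mulrC ler_wpM2r// gerBl indicE//.
    by apply/funext => y; rewrite /F !normrM (ger0_norm (green_ge0 _ _)) ger0_norm//=; ring.
  by apply: absumZ; rewrite ge0_absum//; exact: Gk.
have sF' x : absum (fun p : X * X => F x (p.2, p.1)) by exact: absum_swap.
have rE x y : rsum (fun z => F x (z, y)) = b x y * rgreen k y.
  by rewrite /rgreen -rsumZ//; exact: eq_rsum.
have FG : calF b (rgreen k).
  apply/calFP => x.
  have sF'' : absum (fun p : X * X => `|F x (p.2, p.1)|) by rewrite ge0_absum//; exact: sF'.
  have [s _] := ge0_rsum_pair _ (fun p => normr_ge0 _) sF''.
  apply: absum_le s => y /=; rewrite -rE.
  apply: ler_norm_rsum; exact: (absum_slice _ y (sF' x)).
split=> // x; rewrite laplE//.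
have -> : rsum (fun y => b x y * rgreen k y) =
    (rsum (b x) + c x) * rgreen k x - k x.
  under eq_rsum do rewrite -rE.
  rewrite (rsum_exchange _ (sF' x)) /=.
  have sk : absum (fun z => \1_[set z] x * k z).
    apply: absum_fin; apply: (@sub_finite_set _ _ [set x]) => // z /=.
    by apply: contraNP => /= zx; rewrite indicE memNset ?mul0r//= => /esym.
  (* Writing k(x) as a sum over z lets the two sides be compared term by term. *)
  have -> : k x = rsum (fun z => \1_[set z] x * k z).
    rewrite (@rsum_fset _ _ [:: x])//.
      by rewrite big_seq1 indicE mem_set// mul1r.
    move=> z; rewrite inE => /eqP zx.
    by rewrite indicE memNset ?mul0r//= => /esym.
  rewrite /rgreen -rsumZ// -rsumB//; last by apply: absumZ.
  apply: eq_rsum => z; rewrite FE rsumZ; last first.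
    by apply: absum_calF; exact: calF_green.
  by rewrite weighted_green_sum; ring.
ring.
Qed.

(** * Superharmonic functions, potentials and the killing term *)

Lemma rgreen_le (k s : X -> R) : calF b s -> (forall x, 0 <= s x) ->
  (forall x, 0 <= k x) -> (forall x, k x <= lapl b c s x) ->
  calG b c o k /\ forall x, 0 <= rgreen k x <= s x.
Proof.
move=> Fs s0 k0 ks; have le_s := green_minimal _ _ Fs s0 k0 ks.
have Gk0 x y : 0 <= G x y * k y by rewrite mulr_ge0// green_ge0.
have Gk : calG b c o k.
  apply/calGP => x; rewrite ge0_absum//.
  exact: le_lt_trans (le_s x) (ltry _).
split=> // x; rewrite rsum_ge0//= -lee_fin ge0_rsum//.
by move/calGP: Gk; exact.
Qed.

(** Riesz decomposition of [s] into the potential G(L s) and a harmonic remainder, from [rgreen_le]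
    with k = L s. *)
Lemma harmonic_residual (s : X -> R) : calF b s -> (forall x, 0 <= s x) ->
  (forall x, 0 <= lapl b c s x) ->
  [/\ calG b c o (lapl b c s),
      forall x, 0 <= s x - rgreen (lapl b c s) x <= s x &
      is_harmonic b c (fun x => s x - rgreen (lapl b c s) x)].
Proof.
move=> Fs s0 Ls; have [Gk le_s] := rgreen_le _ _ Fs s0 Ls (fun=> lexx _).
have [FG LG] := lapl_rgreen _ Gk.
split=> // [x|].
  by have /andP[g0 gs] := le_s x; rewrite subr_ge0 gs gerBl.
by split=> [|x]; [exact: calFB|rewrite laplB// LG subrr].
Qed.

(** Minimum principle: at a zero of [h] the equation reads sum_y b(x,y) h(y) = 0, so [h] vanishes at
    all neighbours, and zeros spread along paths. *)
Lemma nonneg_harmonic_eq0 (h : X -> R) x : (forall y, 0 <= h y) ->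
  is_harmonic b c h -> h x = 0 -> forall y, h y = 0.
Proof.
move=> h0 [Fh Lh] hx y; have [p [+ <-]] := hconn x y.
elim: p x hx => [//|z p IH] x hx /= /andP[bxz]; apply: IH.
have := Lh x; rewrite laplE// hx !mulr0 addr0 sub0r => /eqP.
rewrite oppr_eq0 => /eqP S0.
have := rsum_eq0 _ _ (absum_calF _ x Fh) S0 z.
move=> /(_ (fun y => mulr_ge0 (b_ge0 x y) (h0 y))) /eqP.
by rewrite mulf_eq0 gt_eqF// => /eqP.
Qed.

Lemma potentialP (u : X -> R) : potential b c o u <->
  exists2 k, calG b c o k & forall x, u x = rgreen k x.
Proof.
split=> [[_ [k Gk ku]]|[k Gk ku]].
  by exists k => // x; apply: EFin_inj; rewrite ku green_opE.
split; first by rewrite (funext ku); case: (lapl_rgreen _ Gk).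
by exists k => // x; rewrite green_opE// ku.
Qed.

Lemma lapl_potential (u k : X -> R) : calG b c o k ->
  (forall x, u x = rgreen k x) -> forall x, lapl b c u x = k x.
Proof. by move=> Gk /funext ->; case: (lapl_rgreen _ Gk). Qed.

Lemma bounded_funP (u : X -> R) :
  bounded_fun u <-> exists2 M, 0 <= M & forall x, `|u x| <= M.
Proof.
split=> [[M [_ uM]]|[M M0 uM]].
  (* [bounded_fun] only provides bounds strictly larger than M. *)
  exists (`|M| + 1) => [|x]; first by rewrite addr_ge0.
  by apply: uM => //; rewrite (le_lt_trans (ler_norm M))// ltrDl.
by exists M; split=> [|N MN x _]; [exact: num_real|exact: le_trans (uM x) (ltW MN)].
Qed.

Lemma rgreenD (k l : X -> R) x : calG b c o k -> calG b c o l ->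
  rgreen (fun y => k y + l y) x = rgreen k x + rgreen l x.
Proof.
move=> /calGP Gk /calGP Gl; rewrite /rgreen -rsumD//.
by apply: eq_rsum => y; rewrite mulrDr.
Qed.

(** Since c = L 1, this is [rgreen_le] with s = 1. *)
Lemma calG_killing : calG b c o c /\ forall x, 0 <= rgreen c x <= 1.
Proof.
apply: (rgreen_le c (fun=> 1)) => //; first exact: calF_cst.
by move=> x; rewrite lapl_cst mulr1.
Qed.

Lemma harmonic_1Bgreen : is_harmonic b c (fun x => 1 - rgreen c x).
Proof.
have [Gc _] := calG_killing; have [FG LG] := lapl_rgreen _ Gc.
have F1 := calF_cst 1.
by split=> [|x]; [exact: calFB|rewrite laplB// lapl_cst LG mulr1 subrr].
Qed.

Lemma green_op_killing x : green_op b c o c x = (rgreen c x)%:E.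
Proof. by rewrite green_opE//; case: calG_killing. Qed.

(** The Liouville property annihilates both 1 - Gc and the harmonic remainder of s = u + M. Hence u
    = G(L s) - M Gc = G(L u). *)
Lemma superharmonic_potential (u : X -> R) :
  (forall u, bounded_fun u -> is_harmonic b c u -> forall x, u x = 0) ->
  bounded_fun u -> is_superharmonic b c u -> potential b c o u.
Proof.
move=> liouville /bounded_funP[M M0 uM] [Fu Lu].
have uM' x : - M <= u x <= M by rewrite -ler_norml.
have [Gc Gc1] := calG_killing.
have one x : rgreen c x = 1.
  apply/eqP; rewrite eq_sym -subr_eq0; apply/eqP.
  apply: (liouville (fun x => 1 - rgreen c x)); last exact: harmonic_1Bgreen.
  apply/bounded_funP; exists 1 => // y.
  by have := Gc1 y; rewrite ler_norml; lra.
have FM := calF_cst M.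
pose s x := u x + M.
have Fs : calF b s by exact: calFD.
have Ls x : lapl b c s x = lapl b c u x + c x * M by rewrite laplD// lapl_cst.
have s0 x : 0 <= s x by have := uM' x; rewrite /s; lra.
have Ls0 x : 0 <= lapl b c s x by rewrite Ls addr_ge0// mulr_ge0.
have [Gk hs hharm] := harmonic_residual _ Fs s0 Ls0.
have h0 : forall x, s x - rgreen (lapl b c s) x = 0.
  apply: (liouville (fun x => s x - rgreen (lapl b c s) x)) => //.
  apply/bounded_funP; exists (2 * M) => [|x]; first by rewrite mulr_ge0.
  by have := hs x; have := uM' x; rewrite /s ler_norml; lra.
have GcM : calG b c o (fun x => - M * c x).
  apply/calGP => x; under eq_fun do rewrite mulrCA; apply: absumZ.
  by move/calGP: Gc; exact.
have Eu y : lapl b c u y = lapl b c s y + - M * c y by rewrite Ls; ring.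
apply/potentialP; exists (lapl b c u) => [|x].
  rewrite (funext Eu); apply/calGP => x; under eq_fun do rewrite mulrDr.
  by apply: absumD; [move/calGP: Gk; exact|move/calGP: GcM; exact].
rewrite (funext Eu) rgreenD//.
have -> : rgreen (fun y => - M * c y) x = - M * rgreen c x.
  rewrite /rgreen -rsumZ; last by move/calGP: Gc; exact.
  by apply: eq_rsum => y; rewrite mulrCA.
by have := h0 x; rewrite one /s; lra.
Qed.

(** The shift s = u + M satisfies L s = M c, so minimality of G(M c) = M bounds M by u + M. *)
Lemma harmonic_ge0 (u : X -> R) : (forall x, rgreen c x = 1) ->
  bounded_fun u -> is_harmonic b c u -> forall x, 0 <= u x.
Proof.
move=> one /bounded_funP[M M0 uM] [Fu Lu] x.
have FM := calF_cst M.
pose s x := u x + M.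
have Fs : calF b s by exact: calFD.
have Ls y : lapl b c s y = M * c y.
  by rewrite laplD// lapl_cst Lu add0r mulrC.
have s0 y : 0 <= s y by have := uM y; rewrite ler_norml /s; lra.
have cM0 y : 0 <= M * c y by rewrite mulr_ge0.
have [_ /(_ x)] := rgreen_le (fun y => M * c y) _ Fs s0 cM0
  (fun y => eq_ind_r (fun r => M * c y <= r) (lexx _) (Ls y)).
have -> : rgreen (fun y => M * c y) x = M * rgreen c x.
  have [/calGP Gc _] := calG_killing.
  rewrite /rgreen -rsumZ//; by apply: eq_rsum => y; rewrite mulrCA.
by rewrite one /s; lra.
Qed.

End WeightedGraph.

(** * The cycle of implications *)

Theorem theorem2 (R : realType) (X : countType) (b : X -> X -> R) (c : X -> R)
    (o : X) (hgraph : is_graph b c) (hconn : connected_graph b)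
    (htrans : transient b c o) :
  [<-> (* (i) *)
       forall u : X -> R, bounded_fun u -> is_harmonic b c u ->
         forall x, u x = 0;
       (* (i.a) *)
       forall u : X -> R, bounded_fun u -> is_superharmonic b c u ->
         potential b c o u;
       (* (i.b) *)
       forall u : X -> R, bounded_fun u -> is_subharmonic b c u ->
         forall x, u x <= 0;
       (* (i.c) *)
       forall u : X -> R, bounded_fun u -> (forall x, 0 <= u x) ->
         is_subharmonic b c u -> forall x, u x = 0;
       (* (ii.a), for some x, for all x, and as membership of 1 *)
       exists x : X, green_op b c o c x = 1%:E;
       forall x : X, green_op b c o c x = 1%:E;
       potential b c o (fun=> 1)].
Proof.
pose Gc : X -> R := @rgreen R X b c o c.
have [calG_c Gc01] : calG b c o c /\ forall x, 0 <= Gc x <= 1.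
  exact: (calG_killing hgraph hconn htrans).
have green_c x : green_op b c o c x = (Gc x)%:E.
  exact: (green_op_killing hgraph hconn htrans).
have harm1B : is_harmonic b c (fun x => 1 - Gc x).
  exact: (harmonic_1Bgreen hgraph hconn htrans).
have Gc_le1 x : 0 <= 1 - Gc x by have := Gc01 x; lra.
tfae.
- move=> liouville u ub su.
  exact: (superharmonic_potential hgraph hconn htrans).
- move=> pot u /bounded_funP[M M0 uM] [Fu Lu] x.
  have FNu : calF b (fun x => - u x) by exact: (calFN hgraph).
  (* The superharmonic function -u is Gk with k = L(-u) >= 0, and G is nonnegative. *)
  have [||k Gk uk] := iffLR (potentialP hgraph hconn htrans _) (pot (fun x => - u x) _ _).
  + by apply/bounded_funP; exists M => // y; rewrite normrN.
  + by split=> // y; rewrite (laplN hgraph)// oppr_ge0.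
  rewrite -oppr_ge0 uk; apply: rsum_ge0 => y.
  rewrite mulr_ge0 ?(green_ge0 hgraph hconn htrans)//.
  by rewrite -(lapl_potential hgraph hconn htrans _ _ Gk uk) (laplN hgraph)// oppr_ge0.
- by move=> sub_le0 u ub u0 su x; apply/eqP; rewrite eq_le u0 sub_le0.
- move=> sub_eq0; exists o; rewrite green_c; congr EFin; apply/eqP.
  have [Fh Lh] := harm1B.
  rewrite eq_sym -subr_eq0; apply/eqP.
  (* Being harmonic with values in [0, 1], 1 - Gc is an admissible test function. *)
  apply: (sub_eq0 (fun x => 1 - Gc x)) => //.
    apply/bounded_funP; exists 1 => // x.
    by have := Gc01 x; rewrite ler_norml; lra.
  by split=> // x; rewrite Lh.
- move=> [x]; rewrite green_c => -[Gcx] y; rewrite green_c; congr EFin.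
  (* One zero of 1 - Gc propagates to all vertices by the minimum principle. *)
  have := nonneg_harmonic_eq0 hgraph hconn _ x Gc_le1 harm1B _ y.
  rewrite /= Gcx subrr => h; apply/esym/eqP; rewrite -subr_eq0; apply/eqP; exact: h.
- move=> Gc1; apply/(potentialP hgraph hconn htrans); exists c => //.
  by move=> x; apply: EFin_inj; rewrite -green_c Gc1.
- move=> /(potentialP hgraph hconn htrans)[k Gk k1] u ub hu x.
  (* The Laplacian recovers the charge of a potential: k = L 1 = c. *)
  have kc : c = k.
    apply/funext => y; rewrite -(lapl_potential hgraph hconn htrans _ _ Gk k1).
    by rewrite lapl_cst mulr1.
  have one y : Gc y = 1 by apply/esym; rewrite (k1 y) -kc.
  (* Nonnegativity for both u and -u. *)
  apply/eqP; rewrite eq_le (harmonic_ge0 hgraph hconn htrans _ one ub hu) andbT.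
  rewrite -oppr_ge0.
  apply: (harmonic_ge0 hgraph hconn htrans (fun x => - u x) one).
    by case/bounded_funP: ub => M M0 uM; apply/bounded_funP; exists M => // y; rewrite normrN.
  by case: hu => Fu Lu; split => [|y]; [exact: (calFN hgraph)|rewrite (laplN hgraph)// Lu oppr0].
Qed.
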